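(* For every integer $n\ge 6$, $I(P_n^{\ast},x)=I(G_{2n},x)$.
   Context: All graphs are finite, simple and undirected. The independence polynomial of a graph $G$ is $I(G,x)=\sum_{k\ge 0} i_kx^k$, where $i_k$ is the number of independent sets of size $k$ in $G$. $P_n$ is the path of order $n$. For a graph $G$, the graph star $G^{\ast}$ is obtained from $G$ by attaching, for each vertex $v$ of $G$, a new vertex $v^{\ast}$ joined by an edge to $v$ only. The trees $G_{2n}$ ($n\ge 5$) are defined recursively. $G_{10}$ is the tree with vertex set $\{v_1,v_2,v_3,v_4,v_5,x_1,x_2,y_1,y_2,z_1\}$ and edges $v_1v_2,\ v_2v_3,\ v_3v_4,\ v_4v_5,\ v_5x_1,\ x_1x_2,\ v_3y_1,\ y_1y_2,\ v_3z_1$. For $n\ge 5$, $G_{2(n+1)}$ is obtained from $G_{2n}$ by adding a disjoint copy of $K_2$ with vertices labelled $v_{n+1}$ and $w_{n+1}$, and joining $v_n$ and $v_{n+1}$ by an edge. *)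

(* Defs.v *)
From HB Require Import structures.
From mathcomp Require Import all_boot all_order all_algebra.

Set Implicit Arguments.
Unset Strict Implicit.
Unset Printing Implicit Defensive.

Import GRing.Theory.
Local Open Scope ring_scope.

Record sgraph := SGraph {
  vertex :> finType;
  adj : rel vertex;
  adj_sym : symmetric adj;
  adj_irrefl : irreflexive adj }.

Arguments adj {s} _ _.

Definition independent (G : sgraph) (S : {set G}) : bool :=
  [forall u in S, forall v in S, ~~ adj u v].

Definition num_indep (G : sgraph) (k : nat) : nat :=
  #|[set S : {set G} | independent S & #|S| == k]|.

Definition indep_poly (G : sgraph) : {poly int} :=
  \sum_(k < #|G|.+1) (num_indep G k)%:R *: 'X^k.

Section Path.
Variable n : nat.

Definition path_adj : rel 'I_n := fun i j => (i.+1 == j :> nat) || (j.+1 == i :> nat).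

Lemma path_adj_sym : symmetric path_adj.
Proof. by move=> i j; rewrite /path_adj orbC. Qed.

Lemma path_adj_irrefl : irreflexive path_adj.
Proof. by move=> i; rewrite /path_adj orbb gtn_eqF. Qed.

Definition path_graph : sgraph := SGraph path_adj_sym path_adj_irrefl.
End Path.

Section Complete.
Variable n : nat.

Definition complete_adj : rel 'I_n := fun i j => i != j.

Lemma complete_adj_sym : symmetric complete_adj.
Proof. by move=> i j; rewrite /complete_adj eq_sym. Qed.

Lemma complete_adj_irrefl : irreflexive complete_adj.
Proof. by move=> i; rewrite /complete_adj eqxx. Qed.

Definition complete_graph : sgraph := SGraph complete_adj_sym complete_adj_irrefl.
End Complete.

(* [inl v] is the original vertex v and [inr v] the new vertex v^*. *)
Section Star.
Variable G : sgraph.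

Definition star_adj : rel (G + G)%type := fun a b =>
  match a, b with
  | inl u, inl v => adj u v
  | inl u, inr v => u == v
  | inr u, inl v => u == v
  | inr _, inr _ => false
  end.

Lemma star_adj_sym : symmetric star_adj.
Proof.
move=> [u|u] [v|v]; [exact: adj_sym | exact: eq_sym | exact: eq_sym | by []].
Qed.

Lemma star_adj_irrefl : irreflexive star_adj.
Proof. by move=> [u|u] //=; rewrite adj_irrefl. Qed.

Definition graph_star : sgraph := SGraph star_adj_sym star_adj_irrefl.
End Star.

(* The disjoint union of G and H together with the single edge g h. *)
Section Link.
Variables (G H : sgraph) (g : G) (h : H).

Definition link_adj : rel (G + H)%type := fun a b =>
  match a, b with
  | inl u, inl v => adj u v
  | inr u, inr v => adj u v
  | inl u, inr v => (u == g) && (v == h)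
  | inr v, inl u => (u == g) && (v == h)
  end.

Lemma link_adj_sym : symmetric link_adj.
Proof. by move=> [u|u] [v|v] //=; rewrite adj_sym. Qed.

Lemma link_adj_irrefl : irreflexive link_adj.
Proof. by move=> [u|u] //=; rewrite adj_irrefl. Qed.

Definition link : sgraph := SGraph link_adj_sym link_adj_irrefl.
End Link.

(* The vertices v1, ..., v5, x1, x2, y1, y2, z1 are numbered 0, ..., 9. *)
Definition G10_edges : seq (nat * nat) :=
  let v1 := 0%N in let v2 := 1%N in let v3 := 2%N in let v4 := 3%N in
  let v5 := 4%N in let x1 := 5%N in let x2 := 6%N in let y1 := 7%N in
  let y2 := 8%N in let z1 := 9%N in
  [:: (v1, v2); (v2, v3); (v3, v4); (v4, v5); (v5, x1); (x1, x2);
      (v3, y1); (y1, y2); (v3, z1)].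

Definition G10_adj : rel 'I_10 := fun i j =>
  ((nat_of_ord i, nat_of_ord j) \in G10_edges)
  || ((nat_of_ord j, nat_of_ord i) \in G10_edges).

Lemma G10_adj_sym : symmetric G10_adj.
Proof. by move=> i j; rewrite /G10_adj orbC. Qed.

Lemma G10_adj_irrefl : irreflexive G10_adj.
Proof.
move=> i; rewrite /G10_adj orbb; apply/negP => /(allP (a := fun e => e.1 != e.2)).
by move/(_ isT); rewrite eqxx.
Qed.

Definition G10 : sgraph := SGraph G10_adj_sym G10_adj_irrefl.

Definition G10_v5 : G10 := Ordinal (isT : (4 < 10)%N).

(* [G_rec k] is the tree G_{2(k+5)} paired with its vertex labelled v_{k+5}. *)
Fixpoint G_rec (k : nat) : {G : sgraph & G} :=
  match k with
  | 0 => existT (fun G : sgraph => vertex G) G10 G10_v5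
  | k'.+1 =>
      let: existT G v := G_rec k' in
      let vnew : complete_graph 2 := ord0 in
      existT (fun G : sgraph => vertex G)
        (link v vnew) (inr vnew : link v vnew)
  end.

(* [G2 n] is G_{2n}; only the values at n >= 5 are meaningful. *)
Definition G2 (n : nat) : sgraph := projT1 (G_rec (n - 5)).

(* Main.v *)
Require Import Defs.
From mathcomp Require Import all_boot all_order all_algebra.

(** Both [P_(n+1)^*] and [G_(2(n+1))] arise from [P_n^*] and [G_(2n)] by linking a copy of
    [K_2] to the last path vertex. Split the independence polynomial of a rooted graph
    according to whether the root is used: the two parts of a link depend only on the two
    parts of the linked graphs. So it suffices that the two parts agree for [n = 5], which
    is a finite enumeration. *)

Set Implicit Arguments.
Unset Strict Implicit.
Unset Printing Implicit Defensive.

Import GRing.Theory.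
Local Open Scope ring_scope.

Definition root_poly (G : sgraph) (g : G) (b : bool) : {poly int} :=
  \sum_(S : {set G} | independent S && ((g \in S) == b)) 'X^#|S|.

Lemma independentP (G : sgraph) (S : {set G}) :
  reflect {in S &, forall u v, ~~ adj u v} (independent S).
Proof.
apply: (iffP forall_inP) => [indS u v uS vS | indS u uS].
  exact: (forall_inP (indS u uS)).
by apply/forall_inP => v vS; exact: indS.
Qed.

Lemma indep_poly_sum (G : sgraph) :
  indep_poly G = \sum_(S : {set G} | independent S) 'X^#|S|.
Proof.
(* A set has at most [#|G|] elements, so [inord] never falls back to its default and the fibre over
   [k] is exactly the sets of size [k]. *)
rewrite (partition_big (fun S : {set G} => inord #|S| : 'I_#|G|.+1) xpredT) //=.
apply: eq_bigr => k _; rewrite /num_indep -sum1_card natr_sum scaler_suml.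
apply: eq_big => [S | S]; rewrite inE.
  by rewrite -val_eqE /= inordK // ltnS max_card.
by case/andP=> _ /eqP ->; rewrite scale1r.
Qed.

Lemma indep_polyE (G : sgraph) (g : G) :
  indep_poly G = root_poly g true + root_poly g false.
Proof.
rewrite indep_poly_sum (bigID (fun S : {set G} => g \in S)) /=.
by congr (_ + _); apply: eq_bigl => S; rewrite ?eqb_id ?eqbF_neg.
Qed.

Lemma root_poly_iso (G H : sgraph) (f : G -> H) (g : G) (b : bool) :
  bijective f -> {mono f : u v / adj u v} -> root_poly (f g) b = root_poly g b.
Proof.
move=> bij_f adj_f; have inj_f := bij_inj bij_f.
have bij_imf : bijective (fun S : {set G} => f @: S).
  apply: inj_card_bij; first exact: imset_inj.
  by rewrite -!cardsT -!powersetT !card_powerset !cardsT (bij_eq_card bij_f).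
rewrite /root_poly (reindex _ (onW_bij _ bij_imf)) /=.
apply: eq_big => [S | S _]; last by rewrite card_imset.
rewrite mem_imset //; congr (_ && _); apply/independentP/independentP => indS.
  by move=> u v uS vS; rewrite -adj_f; apply: indS; exact: imset_f.
by move=> _ _ /imsetP[u uS ->] /imsetP[v vS ->]; rewrite adj_f; exact: indS.
Qed.

Section LinkPoly.
Variables (G H : sgraph) (g : G) (h : H).

Definition link_set (AB : {set G} * {set H}) : {set link g h} :=
  [set x : G + H | match x with inl u => u \in AB.1 | inr v => v \in AB.2 end].

Lemma link_set_bij : bijective link_set.
Proof.
exists (fun S : {set link g h} =>
          ([set u | (inl u : link g h) \in S], [set v | (inr v : link g h) \in S])).
  by case=> A B; congr (_, _); apply/setP => x; rewrite inE in_set.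
by move=> S; apply/setP => -[u|v]; rewrite in_set /= in_set.
Qed.

Lemma card_link_set A B : #|link_set (A, B)| = (#|A| + #|B|)%N.
Proof.
rewrite -!sum1_card big_sumType /=.
by congr (_ + _)%N; apply: eq_bigl => x; rewrite inE.
Qed.

Lemma independent_link_set A B :
  independent (link_set (A, B)) =
  [&& independent A, independent B & ~~ ((g \in A) && (h \in B))].
Proof.
apply/independentP/and3P => [indS | [/independentP indA /independentP indB ngh]].
  split.
  - by apply/independentP => u v uA vA; apply: (indS (inl u) (inl v)); rewrite inE.
  - by apply/independentP => u v uB vB; apply: (indS (inr u) (inr v)); rewrite inE.
  apply/negP => /andP[gA hB].
  by have := indS (inl g) (inr h); rewrite !inE /= gA hB !eqxx => /(_ isT isT).
move=> [u|u] [v|v]; rewrite !inE /=; [exact: indA | | | exact: indB].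
- move=> uA vB; apply: contra ngh => /andP[/eqP <- /eqP <-].
  by rewrite uA vB.
- move=> uB vA; apply: contra ngh => /andP[/eqP <- /eqP <-].
  by rewrite uB vA.
Qed.

(** If [h] is used, the linking edge forces the [G] part to avoid [g]; otherwise the [G] part is any
    independent set. The [H] part is free in both cases. *)
Lemma root_poly_link b :
  root_poly (inr h : link g h) b =
  (if b then root_poly g false else root_poly g true + root_poly g false)
  * root_poly h b.
Proof.
rewrite -indep_polyE indep_poly_sum /root_poly (reindex _ (onW_bij _ link_set_bij)) /=.
(* One condition covers both values of [b], so the product expands to a single sum over pairs; there
   [b] stands for [h \in B]. *)
have -> : (if b then \sum_(A | independent A && ((g \in A) == false)) 'X^#|A|
           else \sum_(A : {set G} | independent A) 'X^#|A|) =
          \sum_(A | independent A && ~~ ((g \in A) && b)) 'X^#|A| :> {poly int}.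
  by case: b; apply: eq_bigl => A; rewrite ?andbT ?andbF ?andbT ?eqbF_neg.
rewrite big_distrlr pair_big /=.
apply: eq_big => [[A B] | [A B] _]; last by rewrite card_link_set exprD.
rewrite independent_link_set inE /=.
by case: (h \in B); case: b; case: (g \in A); case: (independent A); case: (independent B).
Qed.
End LinkPoly.

Section Enumeration.
Variable G : sgraph.
Implicit Types (l s : seq G).

(** Branches on whether the head vertex is used. Sequences replace finite sets so that the
    enumeration can be evaluated. *)
Fixpoint indep_seqs l : seq (seq G) :=
  if l is v :: l' then
    indep_seqs l' ++ [seq v :: s | s <- indep_seqs l' & ~~ has (adj v) s]
  else [:: [::]].

(** Ensures that the sequences listed from a duplicate-free [l] are themselves duplicate-free, so
    [size] is a cardinality. *)
Lemma indep_seqs_subseq l s : s \in indep_seqs l -> subseq s l.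
Proof.
elim: l s => [|v l IHl] s /=; first by rewrite inE => /eqP ->.
rewrite mem_cat => /orP[/IHl sl | /mapP[t]].
  exact: subseq_trans sl (subseq_cons l v).
by rewrite mem_filter => /andP[_ /IHl tl] ->; rewrite /= eqxx.
Qed.

Lemma independent_setU1 (v : G) (S : {set G}) :
  independent (v |: S) = independent S && ~~ [exists u in S, adj v u].
Proof.
apply/independentP/andP => [indS | [/independentP indS /exists_inPn vS]].
  split; first by apply/independentP => u w uS wS; rewrite indS // setU1r.
  by apply/exists_inPn => u uS; rewrite indS ?setU11 // setU1r.
move=> u w; rewrite !inE => /predU1P[->|uS] /predU1P[->|wS].
- by rewrite adj_irrefl.
- exact: vS.
- by rewrite adj_sym vS.
- exact: indS.
Qed.

(** Induction on [l] with [F] arbitrary: the sets containing the head [v] call for the hypothesis at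
    [F (v |: S)], cut to 0 when [v] has a neighbour in [S]. *)
Lemma sum_indep_seqs (F : {set G} -> {poly int}) l : uniq l ->
  \sum_(S : {set G} | independent S && (S \subset [set x in l])) F S =
  \sum_(s <- indep_seqs l) F [set x in s].
Proof.
elim: l F => [|v l IHl] F /=.
  rewrite big_seq1 set_nil => _; apply: big_pred1 => S; rewrite subset0 /=.
  by case: eqP => [->|_]; rewrite ?andbF // andbT; apply/independentP => u v; rewrite inE.
case/andP=> vl /IHl IH; rewrite big_cat /= big_map big_filter -IH [X in _ = _ + X]big_mkcond /=.
under [X in _ = _ + X]eq_bigr => s _.
  have -> : has (adj v) s = [exists u in [set x in s], adj v u].
    by apply/hasP/exists_inP => -[u us vu]; exists u; rewrite // inE in us *.
  rewrite set_cons; over.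
rewrite -(IH (fun S => if ~~ [exists u in S, adj v u] then F (v |: S) else 0)).
rewrite -big_mkcondr set_cons (bigID (fun S : {set G} => v \notin S)) /=.
have vl' : v \notin [set x in l] by rewrite inE.
congr (_ + _).
  apply: eq_bigl => S; rewrite -andbA -subsetD1; congr (_ && (S \subset _)).
  by rewrite setU1K.
rewrite (reindex_onto (fun S => v |: S) (fun S => S :\ v)) /=; last first.
  by move=> S /andP[_]; rewrite negbK; exact: setD1K.
apply: eq_bigl => S; rewrite setU11 andbT independent_setU1.
(* No such [S] is counted on either side: removing [v] from [v |: S] does not return [S], and [S] is
   not contained in [l]. *)
have [vS|vS] := boolP (v \in S).
  rewrite [S \subset _](contraNF _ vl') ?andbF //=; last by move/subsetP/(_ v vS).
  by apply/andP => -[_ /eqP/setP/(_ v)]; rewrite !inE eqxx vS.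
rewrite setU1K // eqxx andbT subUset sub1set setU11 /= andbAC; congr (_ && _ && _).
by rewrite -[in RHS](setU1K vl') subsetD1 vS andbT.
Qed.

(** Each set is reduced to its size and its use of the root, data whose type no longer depends on
    the graph, so that two graphs can be compared. *)
Lemma root_poly_indep_seqs (g : G) (l : seq G) (b : bool) :
    uniq l -> (forall x, x \in l) ->
  root_poly g b = \sum_(p <- [seq (size s, g \in s) | s <- indep_seqs l] | p.2 == b) 'X^(p.1).
Proof.
move=> uniq_l l_full; rewrite big_map /= /root_poly big_mkcondr /=.
have lT (S : {set G}) : S \subset [set x in l] by apply/subsetP => x; rewrite inE l_full.
transitivity (\sum_(S : {set G} | independent S && (S \subset [set x in l]))
                (if (g \in S) == b then 'X^#|S| else 0 : {poly int})).
  by apply: eq_bigl => S; rewrite lT andbT.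
rewrite sum_indep_seqs // [RHS]big_mkcond; apply: eq_big_seq => s /indep_seqs_subseq sl.
by rewrite inE cardsE (card_uniqP (subseq_uniq sl uniq_l)).
Qed.
End Enumeration.

Lemma root_poly_path_star (n : nat) (b : bool) :
  root_poly (inl ord_max : graph_star (path_graph n.+2)) b =
  root_poly
    (inr ord0 : link (inl ord_max : graph_star (path_graph n.+1)) (ord0 : complete_graph 2)) b.
Proof.
(* The vertex [ord0] of the new [K_2] becomes the last path vertex, and the other one its pendant
   vertex. *)
pose f (x : link (inl ord_max : graph_star (path_graph n.+1)) (ord0 : complete_graph 2))
    : graph_star (path_graph n.+2) :=
  match x with
  | inl (inl i) => inl (widen_ord (leqnSn n.+1) i)
  | inl (inr i) => inr (widen_ord (leqnSn n.+1) i)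
  | inr j => if j == ord0 then inl ord_max else inr ord_max
  end.
rewrite -[inl ord_max]/(f (inr ord0)); apply: root_poly_iso.
  apply: inj_card_bij => [x y|]; last by rewrite !card_sum !card_ord !addnS !addn0 addSn.
  have lt_neq (i : 'I_n.+1) : (i : nat) <> n.+1 by apply/eqP; rewrite ltn_eqF.
  case: x y => [[i|i]|[[|[|//]] hi]] [[j|j]|[[|[|//]] hj]] //= E;
    try (by congr inr; exact: val_inj); case: E => E;
    by [congr (inl (inl _)); apply: val_inj | congr (inl (inr _)); apply: val_inj
       | case: (lt_neq _ E) | case: (lt_neq _ (esym E))].
have lt1 (i : 'I_n.+1) : (i == n.+1 :> nat) = false by rewrite ltn_eqF.
have lt2 (i : 'I_n.+1) : (n.+2 == i :> nat) = false by rewrite gtn_eqF // ltnS ltnW.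
case=> [[i|i]|[[|[|//]] hi]] [[j|j]|[[|[|//]] hj]] //=;
  rewrite /complete_adj /path_adj -?val_eqE /= ?eqSS ?lt2 ?lt1 ?(eq_sym n.+1) ?lt1
    ?(ltn_eqF (ltnSn n)) ?eqxx ?andbT ?andbF ?orbF //=.
Qed.

(** These trees are not isomorphic, since [v3] has degree 4 while the star of the path has maximum
    degree 3; hence the enumeration. *)
Lemma root_poly_star_path5_G10 (b : bool) :
  root_poly (inl ord_max : graph_star (path_graph 5)) b = root_poly G10_v5 b.
Proof.
(* Reduction modulo [n.+1] makes [o] total with a uniform bound proof; it keeps every [k <= n]. *)
pose o n k : 'I_n.+1 := Ordinal (ltn_pmod k (ltn0Sn n)).
pose lP : seq (graph_star (path_graph 5)) :=
  [seq inl (o 4 k) | k <- iota 0 5] ++ [seq inr (o 4 k) | k <- iota 0 5].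
pose lG : seq G10 := [seq o 9 k | k <- iota 0 10].
have o_full n (i : 'I_n.+1) : exists2 k, k \in iota 0 n.+1 & i = o n k.
  exists (val i); first by rewrite mem_iota add0n /= ltn_ord.
  by apply: val_inj; rewrite /= modn_small.
rewrite (@root_poly_indep_seqs _ _ lP) //; last first.
  move=> x; rewrite mem_cat; case: x => i; have [k ks ->] := o_full _ i.
    by apply/orP; left; apply: (map_f (fun k => inl (o 4 k))).
  by apply/orP; right; apply: (map_f (fun k => inr (o 4 k))).
rewrite (@root_poly_indep_seqs _ _ lG) //; last first.
  by move=> i; have [k ks ->] := o_full _ i; apply: map_f.
(* The two lists of pairs are permutations of each other, which settles both values of [b] at
   once. *)
by apply: perm_big; vm_compute.
Qed.

(** The induction keeps [b] general because the [false] part of a link involves both parts of the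
    linked graph. *)
Lemma root_poly_star_path_G_rec (k : nat) (b : bool) :
  root_poly (inl ord_max : graph_star (path_graph (k + 4)%N.+1)) b =
  root_poly (projT2 (G_rec k)) b.
Proof.
elim: k b => [|k IHk] b; first exact: root_poly_star_path5_G10.
rewrite addSn root_poly_path_star root_poly_link.
by rewrite !IHk /=; case: (G_rec k) => G v /=; rewrite root_poly_link.
Qed.

Local Close Scope ring_scope.

Theorem theorem4p4 (n : nat) (hn : 6 <= n) :
  indep_poly (graph_star (path_graph n)) = indep_poly (G2 n).
Proof.
have {hn} [k -> ->] : exists2 k, n = k + 5 & G2 n = projT1 (G_rec k).
  by exists (n - 5) => //; rewrite subnK // ltnW.
(* The roots are the last path vertex and the vertex [v_n] carried by [G_rec]. *)
rewrite addnS (indep_polyE (inl ord_max : graph_star (path_graph (k + 4).+1))).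
rewrite (indep_polyE (projT2 (G_rec k))).
by rewrite !root_poly_star_path_G_rec.
Qed.
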